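(* Let $G$ be a finite non-abelian group, let $H$ be an abelian non-trivial subgroup of $G$ with $H \neq Z(H,G)$, and let $g \in K(H,G)$. Let $|E(\Gamma_{H,G}^g)|$ denote the number of edges of $\Gamma_{H,G}^g$. Then: (a) If $g = 1$, then $|E(\Gamma_{H,G}^g)| = |H||G|\left(1 - \mathrm{Pr}_g(H,G)\right)$. (b) If $g \neq 1$ and $g^2 = 1$, then $2|E(\Gamma_{H,G}^g)| = 2|H||G|\left(1 - \mathrm{Pr}_g(H,G)\right) - |H|^2 - |H|$. (c) If $g \neq 1$ and $g^2 \neq 1$, then $2|E(\Gamma_{H,G}^g)| = 2|H||G|\left(1 - \sum_{u = g,g^{-1}} \mathrm{Pr}_u(H,G)\right) - |H|^2 - |H|$.
   Context: For $x,y$ in a group, $[x,y] = x^{-1}y^{-1}xy$. For a subgroup $H$ of $G$: $Z(H,G) = \{x \in H : xy = yx \text{ for all } y \in G\}$ and $K(H,G) = \{[x,y] : x \in H,\ y \in G\}$. The relative $g$-noncommuting graph $\Gamma_{H,G}^g$ is the simple undirected graph with vertex set $G$ in which two distinct vertices $x,y$ are adjacent if and only if ($x \in H$ or $y \in H$) and $[x,y] \neq g$ and $[x,y] \neq g^{-1}$. For an element $u \in G$, $\mathrm{Pr}_u(H,G) = \frac{|\{(x,y) \in H\times G : [x,y] = u\}|}{|H||G|}$. *)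

(* Defs.v *)
From HB Require Import structures.
From mathcomp Require Import all_boot all_order all_algebra all_fingroup.

Set Implicit Arguments.
Unset Strict Implicit.
Unset Printing Implicit Defensive.

Import Order.TTheory GRing.Theory Num.Theory.

Section RelativeNoncommutingGraph.

Variable gT : finGroupType.
Implicit Types (H G : {set gT}) (g u x y : gT).

(* [~ x, y] is x^-1 * (y^-1 * (x * y)). Adjacency is symmetric, because
   [~ y, x] is the inverse of [~ x, y]. *)
Definition nc_adj H g : rel gT := fun x y =>
  [&& x != y, (x \in H) || (y \in H), [~ x, y]%g != g & [~ x, y]%g != (g^-1)%g].

(* Edges are unordered pairs of vertices. *)
Definition nc_edges H G g : {set {set gT}} :=
  [set [set x; y] | x in G, y in G & nc_adj H g x y].

Definition Pr H G u : rat :=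
  (#|[set p in setX H G | [~ p.1, p.2]%g == u]|%:R / (#|H|%:R * #|G|%:R))%R.

End RelativeNoncommutingGraph.

(* Main.v *)
Require Import Defs.
From mathcomp Require Import all_boot all_order all_algebra all_fingroup.
From mathcomp Require Import zify lra.

Import GRing.Theory Num.Theory.

Local Open Scope ring_scope.

(** Counting ordered pairs proves all three formulas at once.  An edge is the
    same thing as two ordered adjacent pairs (lemma [card_edges_double]), and
    the ordered adjacent pairs are those with first entry in [H] together with
    those with second entry in [H].  Swapping the entries exchanges these two
    families, because [[~ y, x]] is the inverse of [[~ x, y]] and adjacency
    excludes both [g] and its inverse; so they have the same size, and
    inclusion-exclusion leaves two counts to make.

    In [H * G], the non-adjacent pairs are those whose commutator is [g] or its
    inverse and those on the diagonal; since [[~ x, x] = 1], the diagonal is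
    contained in the former when [g = 1] and disjoint from them otherwise
    ([card_nc_left]).  In
    [H * H], all commutators are [1] as [H] is abelian, so no pair is adjacent
    when [g = 1], and every pair off the diagonal is otherwise
    ([nc_left_both]).  The resulting identity [nc_edges_count] has correction
    terms that appear only for [g != 1].  The cases (b) and (c) then differ in
    whether [g] and its inverse are one value of the commutator or two. *)

(** For a symmetric irreflexive relation, each edge [[set x; y]] is the image
    of exactly two ordered pairs, [(x, y)] and [(y, x)]. *)
Lemma card_edges_double (T : finType) (A : {set T}) (e : rel T) :
    symmetric e -> irreflexive e ->
  (2 * #|[set [set x; y] | x in A, y in A & e x y]|
    = #|[set p in setX A A | e p.1 p.2]|)%N.
Proof.
move=> e_sym e_irr; pose S := [set p in setX A A | e p.1 p.2].
pose ends (p : T * T) := [set p.1; p.2].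
have -> : [set [set x; y] | x in A, y in A & e x y] = ends @: S.
  apply/setP=> E; apply/imset2P/imsetP=> [[x y xA] | [[x y]]].
    rewrite inE => /andP[yA exy] ->.
    by exists (x, y); rewrite ?inE /= ?xA ?yA.
  rewrite !inE /= => /andP[/andP[xA yA] exy] ->.
  by exists x y; rewrite ?inE ?yA.
rewrite -[#|S|]sum1_card (partition_big_imset ends) /=.
rewrite (eq_bigr (fun=> 2%N)) ?sum_nat_const ?(mulnC 2%N) // => E.
case/imsetP=> [[x y]]; rewrite !inE /= => /andP[/andP[xA yA] exy] ->.
have neq_xy : x != y by apply: contraTneq exy => ->; rewrite e_irr.
have <- : #|[set (x, y); (y, x)]| = 2%N.
  by rewrite cards2 xpair_eqE negb_and neq_xy.
rewrite -sum1_card; apply: eq_bigl => -[a b].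
rewrite !inE /= !xpair_eqE; apply/idP/idP; last first.
  case/orP=> /andP[/eqP-> /eqP->]; rewrite xA yA ?exy ?eqxx //=.
  by rewrite e_sym exy /ends /= setUC eqxx.
case/andP=> /andP[_ eab] /eqP/setP eqE.
(* Both a and b lie in {x, y}, and they differ since e is irreflexive. *)
have := eqE a; have := eqE b; rewrite !inE !eqxx orbT /=.
have neq_ab : a != b by apply: contraTneq eab => ->; rewrite e_irr.
do 2![move/esym/orP; case=> /eqP ?]; subst; rewrite ?eqxx ?orbT //;
  by rewrite eqxx in neq_ab.
Qed.

Section Count.

Variables (gT : finGroupType) (G H : {group gT}) (g : gT).
Hypotheses (sHG : H \subset G) (abH : abelian H).

Lemma nc_adj_sym : symmetric (nc_adj H g).
Proof.
move=> x y; rewrite /nc_adj eq_sym orbC -(invg_comm y x).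
by rewrite eqg_inv eqg_invLR; congr [&& _, _ & _]; rewrite andbC.
Qed.

Lemma nc_adj_irr : irreflexive (nc_adj H g).
Proof. by move=> x; rewrite /nc_adj eqxx. Qed.

Let nc_pairs := [set p in setX G G | nc_adj H g p.1 p.2].
Let nc_left := [set p in setX H G | nc_adj H g p.1 p.2].
Let hits := [set p in setX H G | [~ p.1, p.2]%g \in [set g; g^-1]%g].
Let swap (p : gT * gT) := (p.2, p.1).

Let diag := [set (x, x) | x in H].

Let card_diag : #|diag| = #|H|.
Proof. by apply: card_imset => x y []. Qed.

Let diagE p : (p \in diag) = (p.1 == p.2) && (p.1 \in H).
Proof.
case: p => x y /=; apply/imsetP/andP => [[z zH [-> ->]] | [/eqP<- xH]] //.
by exists x.
Qed.

(** The commutators on the diagonal are [1], so the diagonal lies inside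
    [hits] when [g = 1] and avoids it otherwise. *)
Lemma card_nc_left :
  (#|nc_left| + #|hits| + (g != 1%g) * #|H| = #|H| * #|G|)%N.
Proof.
rewrite -cardsX -(cardsID hits (setX H G)) -(cardsID diag (_ :\: hits)).
have -> : setX H G :&: hits = hits.
  by apply/setIidPr/subsetP=> p; rewrite inE => /andP[].
have -> : setX H G :\: hits :\: diag = nc_left.
  apply/setP=> -[x y]; rewrite in_setD diagE !inE /nc_adj /=.
  by case: (x \in H); case: (y \in G); rewrite /= ?andbF ?andbT ?negb_or.
suff -> : #|(setX H G :\: hits) :&: diag| = ((g != 1%g) * #|H|)%N by lia.
have [g1 | g'1] := eqVneq g 1%g.
  apply/eqP; rewrite mul0n cards_eq0 -subset0; apply/subsetP=> -[x y].
  rewrite in_setI diagE !inE /= => /andP[/andP[hit xyHG] /andP[/eqP exy _]].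
  by move: hit; rewrite xyHG exy commgg g1 eqxx.
rewrite mul1n -card_diag; congr #|pred_of_set _|; apply/setIidPr/subsetP=> -[x y].
rewrite diagE !inE /= => /andP[/eqP<- xH].
by rewrite xH (subsetP sHG) // commgg !(eq_sym 1%g) invg_eq1 (negPf g'1).
Qed.

(** For [x] and [y] in [H], [[~ x, y] = 1], so such distinct [x] and [y] are
    adjacent exactly when [g != 1]. *)
Lemma nc_left_both :
  (#|nc_left :&: swap @^-1: nc_left| + (g != 1%g) * #|H|
    = (g != 1%g) * #|H| ^ 2)%N.
Proof.
have comm1 x y : x \in H -> y \in H -> [~ x, y]%g = 1%g.
  by move=> xH yH; apply/eqP/commgP/(centsP abH).
have memI x y : ((x, y) \in nc_left :&: swap @^-1: nc_left)
    = [&& x \in H, y \in H, x != y & g != 1%g].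
  rewrite !inE /= (nc_adj_sym y x) /nc_adj.
  case xH: (x \in H); last by [].
  case yH: (y \in H); last by rewrite /= ?andbF.
  rewrite !(subsetP sHG) // comm1 //= andbb.
  by rewrite !(eq_sym 1%g) invg_eq1 andbb.
have [g1 | g'1] := eqVneq g 1%g.
  rewrite !mul0n addn0; apply/eqP; rewrite cards_eq0 -subset0.
  by apply/subsetP=> -[x y]; rewrite memI g1 eqxx !andbF.
have -> : nc_left :&: swap @^-1: nc_left = setX H H :\: diag.
  apply/setP=> -[x y]; rewrite memI in_setD diagE in_setX g'1 /=.
  by case: (x \in H); case: (y \in H); rewrite ?andbF ?andbT.
rewrite !mul1n -mulnn -cardsX -(cardsID diag (setX H H)) addnC -card_diag.
congr (#|pred_of_set _| + _)%N; apply/esym/setIidPr/subsetP=> -[x y].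
by rewrite diagE !inE /= => /andP[/eqP<- ->].
Qed.

(** Inclusion-exclusion for the pairs with an entry in [H]: [swap] exchanges
    those with first entry in [H] and those with second entry in [H]. *)
Lemma card_nc_pairs :
  (#|nc_pairs| + #|nc_left :&: swap @^-1: nc_left| = 2 * #|nc_left|)%N.
Proof.
have swapK : involutive swap by case.
have -> : nc_pairs = nc_left :|: swap @^-1: nc_left.
  apply/setP=> -[x y]; rewrite !inE /= (nc_adj_sym y x) /nc_adj.
  have GH z : z \in H -> z \in G by apply: (subsetP sHG).
  case xH: (x \in H); case yH: (y \in H); rewrite /= ?andbF ?orbF ?orbb //.
  - by rewrite !GH //= orbb.
  - by rewrite (GH x).
  by rewrite (GH y) ?andbT.
rewrite cardsUI card_preimset ?mul2n ?addnn //.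
exact: inv_inj.
Qed.

Lemma nc_edges_count :
  (2 * #|nc_edges H G g| + 2 * #|hits| + (g != 1%g) * (#|H| ^ 2 + #|H|)
    = 2 * (#|H| * #|G|))%N.
Proof.
have -> : (2 * #|nc_edges H G g| = #|nc_pairs|)%N.
  exact: card_edges_double nc_adj_sym nc_adj_irr.
have := card_nc_left; have := nc_left_both; have := card_nc_pairs.
case: (g != 1%g); lia.
Qed.

End Count.

(** The denominator of [Pr] is nonzero since both sets are groups. *)
Lemma Pr_count (gT : finGroupType) (G H : {group gT}) (u : gT) :
  #|H|%:R * #|G|%:R * Pr H G u
    = #|[set p in setX H G | [~ p.1, p.2]%g == u]|%:R.
Proof.
rewrite /Pr mulrC divfK // mulf_neq0 // pnatr_eq0 -lt0n;
  exact: cardG_gt0.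
Qed.

(* 'C_H(G) is Z(H, G) and commg_set H G is K(H, G). *)
Theorem corollary3p2 (gT : finGroupType) (G H : {group gT}) (g : gT)
    (nonabG : ~~ abelian G) (sHG : H \subset G) (abH : abelian H)
    (ntH : H :!=: 1%g) (neqHZ : H :!=: 'C_H(G)%g) (gK : g \in commg_set H G) :
  [/\ g = 1%g ->
        #|nc_edges H G g|%:R = #|H|%:R * #|G|%:R * (1 - Pr H G g),
      g <> 1%g -> (g ^+ 2)%g = 1%g ->
        2%:R * #|nc_edges H G g|%:R
          = 2%:R * #|H|%:R * #|G|%:R * (1 - Pr H G g)
            - #|H|%:R ^+ 2 - #|H|%:R
    & g <> 1%g -> (g ^+ 2)%g <> 1%g ->
        2%:R * #|nc_edges H G g|%:R
          = 2%:R * #|H|%:R * #|G|%:R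
              * (1 - \sum_(u <- [:: g; (g^-1)%g]) Pr H G u)
            - #|H|%:R ^+ 2 - #|H|%:R ].
Proof.
pose N u := #|[set p in setX H G | [~ p.1, p.2]%g == u]|.
pose hits := [set p in setX H G | [~ p.1, p.2]%g \in [set g; g^-1]%g].
have count : (2 * #|nc_edges H G g| + 2 * #|hits|
    + (g != 1%g) * (#|H| ^ 2 + #|H|) = 2 * (#|H| * #|G|))%N.
  exact: nc_edges_count.
have PrN u : #|H|%:R * #|G|%:R * Pr H G u = (N u)%:R by apply: Pr_count.
have sqg : ((g ^+ 2)%g == 1%g) = ((g^-1)%g == g).
  by rewrite expgS expg1 -eq_invg_mul.
have hits1 : (g^-1)%g = g -> #|hits| = N g.
  by move=> gV; rewrite /hits gV setUid; apply: eq_card => p; rewrite !inE.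
have hits2 : (g^-1)%g != g -> #|hits| = (N g + N (g^-1)%g)%N.
  move=> gV; rewrite /N -cardsUI [X in (_ + X)%N]eq_card0 ?addn0.
    by apply: eq_card => p; rewrite !inE andb_orr.
  move=> p; rewrite !inE; apply: contraNF gV.
  by case/andP=> /andP[_ /eqP->] /andP[_]; rewrite eq_sym.
move/(congr1 (fun n => n%:R : rat)): count.
rewrite !natrD !natrM natrD natrX => count.
split=> [g1 | /eqP g'1 /eqP | /eqP g'1 /eqP]; rewrite ?sqg.
- move: count; rewrite hits1 g1 ?invg1 // eqxx mul0r addr0 -PrN => count; lra.
- move/eqP=> gV; move: count; rewrite hits1 // g'1 mul1r -PrN => count; lra.
move=> gV; move: count; rewrite hits2 // g'1 mul1r natrD -!PrN => count.
by rewrite !big_cons big_nil; lra.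
Qed.
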